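(* Let $A_1,\dots,A_c$ be $n\times n$ matrices with entries in a commutative ring, indexed by $[n]$, and let $\alpha(x)=\alpha(A_1,\dots,A_c;x)$ be their additive characteristic polynomial. Then for every integer $k\ge1$, $$p_k(\mathrm{roots}(\alpha))=\sum_{\substack{\widetilde\omega\in\mathsf{FrWalk}(A_1,\dots,A_c)\\ \ell(\widetilde\omega)=k}}w(\widetilde\omega),$$ where $\mathsf{FrWalk}(A_1,\dots,A_c)$ is the set of closed freelike walks of nonzero weight, and $\ell$ and $w$ denote length and weight.
   Context: Walks: a walk of length $t$ on $[n]$ is a sequence of vertices $v_0v_1\cdots v_t$, also viewed as the sequence of arcs $(v_i,v_{i+1})$ ($v_i=v_{i+1}$ is allowed); it is closed if $v_0=v_t$. It is self-avoiding if all its vertices are distinct, except that $v_0=v_t$ is allowed. For a matrix $A$ the weight of a walk $\omega$ is $w_A(\omega)=\prod_{(i,j)\in\omega}A_{ij}$. A cycle is a self-avoiding closed walk of length at least $1$ with its starting point forgotten (so self-loops are cycles of length 1, and $i\to j\to i$ with $i\neq j$ is a cycle of length 2). A colored cycle is a pair $\tilde\gamma=(\gamma,j)$ with $\gamma$ a cycle on $[n]$ and color $j\in[c]$; its weight is $w(\tilde\gamma)=w_{A_j}(\gamma)$, its length $\ell(\tilde\gamma)$ that of $\gamma$. Additive characteristic polynomial: a trivial heap $M$ is a set of pairwise vertex-disjoint colored cycles of nonzero weight (possibly empty); $\ell(M)=\sum_{\tilde\gamma\in M}\ell(\tilde\gamma)$, $w(M)=\prod_{\tilde\gamma\in M}w(\tilde\gamma)$,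 and $|M|$ is the number of colored cycles in $M$. Then $$\alpha(A_1,\dots,A_c;x)=\sum_{k=0}^n b_kx^{n-k},\qquad b_k=\sum_{M:\ \ell(M)=k}(-1)^{|M|}w(M).$$ Freelike walks: a walk $\omega=(u_0,\dots,u_T)$ is decomposed by loop-erasing: follow the walk until the first repetition of a vertex, $u_s=u_t$ with $s<t$; the cycle $(u_s,u_{s+1},\dots,u_t=u_s)$ is the first piece. Delete this piece (leaving one occurrence of $u_s$) and repeat from $u_0$, until no vertex is repeated. A closed walk thereby decomposes into a sequence of pieces (cycles), leaving only the vertex $u_0$. A closed freelike walk $\widetilde\omega$ is a closed walk together with an assignment of a color in $[c]$ to each of its pieces; its weight $w(\widetilde\omega)$ is the product of the weights of its pieces (as colored cycles), and its length is that of the underlying walk. Power sums: for a monic polynomial $f(x)=x^n+\sum_{k=1}^n(-1)^ke_kx^{n-k}$ over a commutative ring, with $e_k=0$ for $k>n$, $p_k(\mathrm{roots}(f))$ is the coefficient of $x^k$ in the formal power series $x^{-1}f'(x^{-1})/f(x^{-1})$; equivalently it is defined by Newton's recursion $p_k=(-1)^{k+1}ke_k+\sum_{i=1}^{k-1}(-1)^{i+1}e_ip_{k-i}$. (For complex $f$ it is the sum of $k$th powers of the roots with multiplicity.) *)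

(* Defs.v *)
From HB Require Import structures.
From mathcomp Require Import all_boot all_order all_algebra.

Set Implicit Arguments.
Unset Strict Implicit.
Unset Printing Implicit Defensive.

Import GRing.Theory.
Local Open Scope ring_scope.

(* A walk v_0 v_1 ... v_t is the non-empty sequence [:: v_0; v_1; ...; v_t];
   the vertex set [n] is 'I_n. *)
Section Walks.
Variable T : eqType.
Implicit Type w : seq T.

Definition arcs w : seq (T * T) := zip w (behead w).

Definition walk_length w : nat := (size w).-1.

Definition closed_walk w : bool :=
  if w is v :: p then last v p == v else false.

(* In a closed walk v :: p the last vertex of p is v, so [uniq p] says that
   all vertices are distinct except for the coincidence of the endpoints. *)
Definition self_avoiding w : bool :=
  if w is v :: p then uniq w || (closed_walk w && uniq p) else false.

(* Least t such that u_s = u_t for some s < t. *)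
Definition first_repeat w : nat :=
  find (fun t => ~~ uniq (take t.+1 w)) (iota 0 (size w)).

(* The s < t with u_s = u_t, for t := first_repeat w. *)
Definition repeat_start w : nat :=
  let t := first_repeat w in
  if drop t w is x :: _ then index x w else t.

(* The piece (u_s, u_(s+1), ..., u_t), and the walk in which this piece is
   replaced by the single vertex u_s = u_t. *)
Definition first_piece w : seq T :=
  drop (repeat_start w) (take (first_repeat w).+1 w).

Definition erase_piece w : seq T :=
  take (repeat_start w) w ++ drop (first_repeat w) w.

(* Each erasure shortens the walk, so [size w] steps are enough; see
   [pieces_nil] and [pieces_cons] for the recursion. *)
Fixpoint pieces_rec (fuel : nat) w : seq (seq T) :=
  if fuel is m.+1 then
    if uniq w then [::] else first_piece w :: pieces_rec m (erase_piece w)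
  else [::].

Definition pieces w : seq (seq T) := pieces_rec (size w) w.

Lemma first_repeatP w : ~~ uniq w ->
  [/\ (first_repeat w < size w)%N, ~~ uniq (take (first_repeat w).+1 w)
    & uniq (take (first_repeat w) w)].
Proof.
move=> Nuw; set P := (fun t => ~~ uniq (take t.+1 w)).
have sw : (0 < size w)%N by case: w Nuw {P}.
have hasP : has P (iota 0 (size w)).
  apply/hasP; exists (size w).-1; first by rewrite mem_iota /= add0n ltn_predL.
  by rewrite /P prednK // take_size.
have lt_t : (first_repeat w < size w)%N.
  by move: hasP; rewrite has_find size_iota.
split=> //.
  by have := nth_find 0 hasP; rewrite nth_iota // add0n.
case def_t: (first_repeat w) => [|t]; first by rewrite take0.
have lt_t' : (t < first_repeat w)%N by rewrite def_t.
have /negbT := before_find 0 lt_t'.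
by rewrite nth_iota ?add0n ?negbK // (ltn_trans lt_t').
Qed.

Lemma repeat_startP w : ~~ uniq w ->
  (repeat_start w < first_repeat w)%N /\
  forall x0, nth x0 w (repeat_start w) = nth x0 w (first_repeat w).
Proof.
move=> Nuw; have x : T by case: w Nuw => [|x].
have [lt_t Nut ut] := first_repeatP Nuw.
rewrite /repeat_start; set t := first_repeat w in lt_t Nut ut *.
rewrite (drop_nth x lt_t).
have y_in : nth x w t \in take t w.
  by move: Nut; rewrite (take_nth x lt_t) rcons_uniq ut andbT negbK.
have lt_i : (index (nth x w t) w < t)%N.
  rewrite -{2}(cat_take_drop t w) index_cat y_in.
  by rewrite -[X in (_ < X)%N](size_takel (ltnW lt_t)) index_mem.
split=> // x0; rewrite (set_nth_default x x0) ?(set_nth_default x x0 lt_t).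
  by rewrite nth_index // mem_nth.
exact: ltn_trans lt_i lt_t.
Qed.

Lemma size_erase_piece w : ~~ uniq w -> (size (erase_piece w) < size w)%N.
Proof.
move=> Nuw; have [lt_t _ _] := first_repeatP Nuw.
have [lt_st _] := repeat_startP Nuw.
have le_sw := ltnW (ltn_trans lt_st lt_t).
rewrite size_cat size_takel // size_drop addnBA ?(ltnW lt_t) //.
by rewrite ltn_subLR ?ltn_add2r // (leq_trans (ltnW lt_t)) // leq_addl.
Qed.

Lemma pieces_nil w : uniq w -> pieces w = [::].
Proof. by rewrite /pieces; case: w => //= x w ->. Qed.

Lemma pieces_cons w : ~~ uniq w ->
  pieces w = first_piece w :: pieces (erase_piece w).
Proof.
have fuelE m m' v : (size v <= m)%N -> (size v <= m')%N ->
    pieces_rec m v = pieces_rec m' v.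
  elim: m m' v => [|m IH] [|m'] v //=; last first.
  - move=> vm vm'; case: ifPn => // Nuv; congr (_ :: _).
    by apply: IH; rewrite -ltnS (leq_trans (size_erase_piece Nuv)).
  - by move=> _; rewrite leqn0 => /nilP->.
  - by rewrite leqn0 => /nilP->.
move=> Nuw; have lt_e := size_erase_piece Nuw.
rewrite {1}/pieces; case def_m: (size w) => [|m]; first by rewrite def_m in lt_e.
rewrite /= (negPf Nuw); congr (_ :: _); apply: fuelE => //.
by rewrite -ltnS -def_m.
Qed.

Lemma first_piece_cycle w : ~~ uniq w ->
  [/\ closed_walk (first_piece w), self_avoiding (first_piece w)
    & (0 < walk_length (first_piece w))%N].
Proof.
move=> Nuw; have x0 : T by case: w Nuw => [|x].
have [lt_t _ ut] := first_repeatP Nuw.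
have [lt_st eq_st] := repeat_startP Nuw.
rewrite /first_piece; set s := repeat_start w in lt_st eq_st *.
set t := first_repeat w in lt_t ut lt_st eq_st *.
rewrite (take_nth x0 lt_t) drop_rcons ?size_takel ?(ltnW lt_t) //; last exact: ltnW.
have lt_s : (s < size (take t w))%N by rewrite size_takel // ltnW.
rewrite (drop_nth x0 lt_s) nth_take // eq_st /=.
have us : uniq (drop s (take t w)) by rewrite drop_uniq.
rewrite (drop_nth x0 lt_s) nth_take // eq_st /= in us.
rewrite last_rcons eqxx /= rcons_uniq us orbT /walk_length /= size_rcons.
by split.
Qed.

End Walks.

Section Cycles.
Variables (R : comNzRingType) (n c : nat).

Local Notation arc := ('I_n * 'I_n)%type.
Implicit Types (w : seq 'I_n) (g : {set arc}).

(* Forgetting the starting point of a self-avoiding closed walk amounts to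
   keeping only its set of arcs (see [arc_set_rot]), so cycles are encoded as
   sets of arcs. *)
Definition arc_set w : {set arc} := [set a in arcs w].

(* The bound on the length t.+1 loses no cycle: see [is_cycleP]. *)
Definition is_cycle g : bool :=
  [exists t : 'I_n, [exists w : (t.+2).-tuple 'I_n,
     [&& closed_walk w, self_avoiding w & g == arc_set w]]].

Definition cycle_length g : nat := #|g|.

Definition cycle_vertices g : {set 'I_n} := [set a.1 | a in g].

Definition colored_cycle : finType := ({set arc} * 'I_c)%type.

Implicit Types (gj : colored_cycle) (M : {set colored_cycle}).

Variable A : 'I_c -> 'M[R]_n.

Definition walk_weight (B : 'M[R]_n) w : R := \prod_(a <- arcs w) B a.1 a.2.

Definition cycle_weight (B : 'M[R]_n) g : R := \prod_(a in g) B a.1 a.2.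

Definition colored_weight gj : R := cycle_weight (A gj.2) gj.1.

Definition colored_length gj : nat := cycle_length gj.1.

Definition trivial_heap M : bool :=
  [forall gj in M, is_cycle gj.1 && (colored_weight gj != 0)] &&
  [forall gj in M, forall hk in M, (gj != hk) ==>
     [disjoint cycle_vertices gj.1 & cycle_vertices hk.1]].

Definition heap_length M : nat := (\sum_(gj in M) colored_length gj)%N.

Definition heap_weight M : R := \prod_(gj in M) colored_weight gj.

Definition additive_coef (k : nat) : R :=
  \sum_(M : {set colored_cycle} | trivial_heap M && (heap_length M == k))
     (-1) ^+ #|M| * heap_weight M.

Definition additive_char_poly : {poly R} :=
  \sum_(k < n.+1) additive_coef k *: 'X^(n - k).

(* A walk of length k with a color for each piece of its loop erasure. *)
Definition colored_walk (k : nat) : finType :=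
  {w : k.+1.-tuple 'I_n & {ffun 'I_(size (pieces w)) -> 'I_c}}.

Definition colored_piece k (W : colored_walk k)
    (i : 'I_(size (pieces (tag W)))) : colored_cycle :=
  (arc_set (nth [::] (pieces (tag W)) i), tagged W i).

Definition freelike_weight k (W : colored_walk k) : R :=
  \prod_(i < size (pieces (tag W))) colored_weight (colored_piece i).

(* The closed freelike walks of length k and nonzero weight. *)
Definition FrWalk (k : nat) : {set colored_walk k} :=
  [set W : colored_walk k | closed_walk (tag W) & freelike_weight W != 0].

End Cycles.

Section CycleFacts.
Variables (R : comNzRingType) (n : nat).
Implicit Types (w : seq 'I_n) (g : {set 'I_n * 'I_n}).

Lemma is_cycleP g :
  reflect (exists2 w, [/\ closed_walk w, self_avoiding w & (0 < walk_length w)%N]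
                    & g = arc_set w)
          (is_cycle g).
Proof.
apply: (iffP existsP) => [[t /existsP[w /and3P[cw sw /eqP gw]]] | [w [cw sw lw] gw]].
  by exists w => //; split; rewrite // /walk_length size_tuple.
have [v [p def_w]] : exists v p, w = v :: p by case: w lw {cw sw gw} => // v p; exists v, p.
have up : uniq p.
  by move: cw sw; rewrite def_w /= => -> /orP[/andP[] | ].
have lt_p : ((size p).-1 < n)%N.
  have := max_card (mem p); rewrite card_ord (card_uniqP up).
  by move: lw; rewrite def_w /walk_length /=; case: (size p).
have szw : size w == (Ordinal lt_p).+2.
  by move: lw; rewrite def_w /walk_length /=; case: (size p).
exists (Ordinal lt_p); apply/existsP; exists (Tuple szw).
by rewrite cw sw gw eqxx.
Qed.

Lemma arcs_cons (v : 'I_n) p : arcs (v :: p) = zip (belast v p) p.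
Proof.
rewrite /arcs /= lastI -cats1 -[X in zip _ X = _]cats0.
by rewrite zip_cat ?size_belast //= cats0.
Qed.

Lemma uniq_arcs w : closed_walk w -> self_avoiding w -> uniq (arcs w).
Proof.
case: w => // v p cw sw; have up : uniq p.
  by move: cw sw => /= -> /orP[/andP[] | ].
by apply: (map_uniq (f := snd)); rewrite arcs_cons -/(unzip2 _) unzip2_zip ?size_belast.
Qed.

Lemma cycle_weight_arc_set (B : 'M[R]_n) w : closed_walk w -> self_avoiding w ->
  cycle_weight B (arc_set w) = walk_weight B w.
Proof.
move=> cw sw; rewrite /cycle_weight /walk_weight big_uniq ?uniq_arcs //=.
by apply: eq_bigl => a; rewrite inE.
Qed.

Lemma cycle_length_arc_set w : closed_walk w -> self_avoiding w ->
  cycle_length (arc_set w) = walk_length w.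
Proof.
move=> cw sw; rewrite /cycle_length cardsE (card_uniqP (uniq_arcs cw sw)).
by case: w {cw sw} => // v p; rewrite arcs_cons size_zip size_belast minnn.
Qed.

Lemma path_arcs (e : rel 'I_n) v p :
  path e v p = all (fun a => e a.1 a.2) (arcs (v :: p)).
Proof. by rewrite arcs_cons; elim: p v => //= x p IH v; rewrite IH. Qed.

Lemma cycle_closed (e : rel 'I_n) v p : closed_walk (v :: p) -> (0 < size p)%N ->
  cycle e p = path e v p.
Proof.
case/lastP: p => // p x /=; rewrite last_rcons => /eqP-> _.
by rewrite -[in LHS]rot1_cons rot_cycle.
Qed.

(* Two self-avoiding closed walks have the same set of arcs if and only if they
   differ by the choice of the starting point. *)
Lemma arc_set_rot (v w : 'I_n) p q :
    closed_walk (v :: p) -> self_avoiding (v :: p) -> (0 < size p)%N ->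
    closed_walk (w :: q) -> self_avoiding (w :: q) -> (0 < size q)%N ->
  arc_set (v :: p) = arc_set (w :: q) <-> exists i, q = rot i p.
Proof.
move=> cp sp p0 cq sq q0.
have up : uniq p by move: cp sp => /= -> /orP[/andP[] | ].
have uq : uniq q by move: cq sq => /= -> /orP[/andP[] | ].
split=> [eq_pq | [i def_q]]; last first.
  apply/esym/eqP; rewrite eqEcard; apply/andP; split; last first.
    rewrite -!/(cycle_length _) !cycle_length_arc_set //.
    by rewrite /walk_length /= def_q size_rot.
  pose e := [rel x y : 'I_n | (x, y) \in arcs (v :: p)].
  have : path e w q.
    rewrite -cycle_closed // def_q rot_cycle (cycle_closed _ cp) //.
    by rewrite path_arcs; apply/allP => -[].
  rewrite path_arcs => /allP sub_e; apply/subsetP => -[x y].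
  by rewrite !inE => /sub_e.
have eq_arcs : arcs (v :: p) =i arcs (w :: q).
  by move=> a; move/setP/(_ a): eq_pq; rewrite !inE.
have snd_arcs (x : 'I_n) s : map snd (arcs (x :: s)) = s.
  by rewrite arcs_cons; apply: unzip2_zip; rewrite size_belast.
have mem_pq : p =i q.
  by move=> x; rewrite -(snd_arcs v p) -(snd_arcs w q); apply: eq_mem_map.
have cyc_p : fcycle (next p) p by exact: cycle_next.
have cyc_q : fcycle (next p) q.
  rewrite (cycle_closed _ cq) // path_arcs -(eq_all_r eq_arcs) -path_arcs.
  by rewrite -(cycle_closed _ cp).
have szpq : size p = size q by apply/perm_size/uniq_perm.
case: q => [|x q] // in q0 mem_pq cyc_q szpq {cq sq uq eq_pq eq_arcs} *.
have x_p : x \in p by rewrite mem_pq mem_head.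
have [i p' def_p'] := rot_to x_p; exists i; rewrite def_p'; congr (_ :: _).
have szp' : size p' = size q.
  by have := congr1 size def_p'; rewrite size_rot szpq /= => -[].
move: cyc_p; rewrite -(rot_cycle i) def_p' /= => /fpathP[m1 def1].
move: cyc_q => /= /fpathP[m2 def2].
have em : m1 = m2.
  move: (congr1 size def1) (congr1 size def2).
  by rewrite !size_rcons !size_traject szp' => <- <-.
by have := def1; rewrite em -def2 => /rcons_inj[].
Qed.

Lemma additive_coef0 c (A : 'I_c -> 'M[R]_n) : additive_coef A 0 = 1.
Proof.
rewrite /additive_coef (bigD1 set0) /=; last first.
  rewrite /heap_length big_set0 eqxx andbT; apply/andP.
  by split; apply/forall_inP => x; rewrite inE.
rewrite cards0 /heap_weight big_set0 mulr1 big1 ?addr0 // => M.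
case/andP=> /andP[/andP[/forall_inP cM _]].
rewrite sum_nat_eq0 => /forall_inP lM /set0Pn[gj gjM].
have /andP[/is_cycleP[w [cw sw lw] gw] _] := cM _ gjM.
by move: (lM _ gjM); rewrite /colored_length gw cycle_length_arc_set // -leqn0 leqNgt lw.
Qed.

Lemma size_additive_tail c (A : 'I_c -> 'M[R]_n) :
  (size (\sum_(k < n) additive_coef A k.+1 *: 'X^(n - k.+1))%R
     < size ('X^n : {poly R})%R)%N.
Proof.
rewrite size_polyXn ltnS; apply: (leq_trans (size_sum _ _ _)).
apply/bigmax_leqP => i _; apply: leq_trans (size_scale_leq _ _) _.
by rewrite size_polyXn; case: n i => [[] | m [i lt_im]] //; rewrite subSS ltnS leq_subr.
Qed.

Lemma additive_char_polyE c (A : 'I_c -> 'M[R]_n) :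
  additive_char_poly A
    = 'X^n + \sum_(k < n) additive_coef A k.+1 *: 'X^(n - k.+1).
Proof.
by rewrite /additive_char_poly big_ord_recl additive_coef0 scale1r subn0.
Qed.

Lemma size_additive_char_poly c (A : 'I_c -> 'M[R]_n) :
  size (additive_char_poly A) = n.+1.
Proof.
by rewrite additive_char_polyE size_polyDl ?size_additive_tail // size_polyXn.
Qed.

Lemma monic_additive_char_poly c (A : 'I_c -> 'M[R]_n) :
  additive_char_poly A \is monic.
Proof.
by rewrite monicE additive_char_polyE lead_coefDl ?size_additive_tail
  ?lead_coefXn.
Qed.

End CycleFacts.

Section PowerSums.
Variable R : comNzRingType.
Implicit Types (f : {poly R}) (k : nat).

(* f = X^d + \sum_(1 <= k <= d) (-1)^k e_k X^(d-k) and e_k = 0 for k > d. *)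
Definition elem_coef f k : R :=
  let d := (size f).-1 in
  if (k <= d)%N then (-1) ^+ k * f`_(d - k) else 0.

(* power_sums f k = [:: p_0; p_1; ...; p_k]; see [power_sumE]. *)
Fixpoint power_sums f k : seq R :=
  if k is k'.+1 then
    let p := power_sums f k' in
    rcons p ((-1) ^+ k.+1 * (k%:R * elem_coef f k)
             + \sum_(1 <= i < k) (-1) ^+ i.+1 * elem_coef f i * p`_(k - i))
  else [:: ((size f).-1)%:R].

(* p_k(roots(f)), for f monic. *)
Definition power_sum_roots f k : R := (power_sums f k)`_k.

Lemma size_power_sums f k : size (power_sums f k) = k.+1.
Proof. by elim: k => //= k IH; rewrite size_rcons IH. Qed.

Lemma nth_power_sums f k j : (j <= k)%N ->
  (power_sums f k)`_j = power_sum_roots f j.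
Proof.
elim: k => [|k IH]; first by rewrite leqn0 => /eqP->.
rewrite leq_eqVlt => /predU1P[-> // | ltjk].
by rewrite /= nth_rcons size_power_sums ltjk IH.
Qed.

Lemma power_sumE f k : (1 <= k)%N ->
  power_sum_roots f k =
    (-1) ^+ k.+1 * (k%:R * elem_coef f k)
    + \sum_(1 <= i < k) (-1) ^+ i.+1 * elem_coef f i * power_sum_roots f (k - i).
Proof.
case: k => // k _; rewrite {1}/power_sum_roots /= nth_rcons size_power_sums.
rewrite ltnn eqxx; congr (_ + _); apply: eq_big_nat => i /andP[i0 ik].
by rewrite nth_power_sums // leq_subLR -addn1 addnC leq_add2r.
Qed.

(* With d = deg f, the relation
     x^d f(x^-1) * \sum_k p_k x^k = x^(d-1) f'(x^-1)
   between formal power series, coefficient by coefficient. *)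
Lemma power_sum_series f k : f \is monic -> let d := (size f).-1 in
  \sum_(i < k.+1) (if (i <= d)%N then f`_(d - i) else 0)
                  * power_sum_roots f (k - i)
    = if (k <= d)%N then f`_(d - k) *+ (d - k) else 0.
Proof.
move=> monf d; have f0 : f`_d = 1 by apply/eqP.
have signE i : (if (i <= d)%N then f`_(d - i) else 0) = (-1) ^+ i * elem_coef f i.
  rewrite /elem_coef -/d; case: ifP; rewrite ?mulr0 // mulrA -exprD addnn.
  by rewrite -signr_odd odd_double mul1r.
have p0 : power_sum_roots f 0 = d%:R by [].
have [->|k_gt0] := posnP k.
  by rewrite big_ord_recl big_ord0 addr0 subn0 f0 mul1r p0.
rewrite -(big_mkord xpredT
  (fun i => (if (i <= d)%N then f`_(d - i) else 0) * power_sum_roots f (k - i))).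
rewrite big_nat_recr // big_ltn //= !subn0 f0 mul1r subnn p0 (power_sumE f k_gt0).
rewrite -[X in X + _]addrA -big_split /= big1 => [|i _]; last first.
  by rewrite signE exprS mulN1r !mulNr addNr.
rewrite addr0 exprS mulN1r mulNr mulrCA -signE.
case: leqP => [le_kd | _]; last by rewrite mulr0 mul0r oppr0 addr0.
by rewrite mulrC -mulrN -mulrDr addrC -natrB // mulr_natr.
Qed.

End PowerSums.

(* Main.v *)
Require Import Defs.
From mathcomp Require Import all_boot all_order all_algebra.
From mathcomp Require Import ring.

(** Write [h_S] for the generating polynomial of the signed heaps of colored
    cycles supported on a vertex set [S] ([heap_poly]), so that [h_V], for the
    whole vertex set [V], has the coefficients of the additive characteristic
    polynomial, and let [W_v] be the generating series of the closed freelike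
    walks at [v]. The heart of the matter is the identity
      [h_V * W_v = h_(V - v)].
    Summed over [v], its right-hand side has [x^k]-coefficient
    [(n - k) * b_k], because a heap of length [k] avoids [n - k] vertices; the
    result is exactly the family of Newton relations that characterizes the
    power sums of the roots ([power_sum_series]), and the theorem follows by
    induction on [k].

    To prove the identity, view loop erasure as a process on self-avoiding
    stacks: each new vertex is either pushed, or it already lies on the stack
    and the part of the stack above it is popped as a piece ([pieces_push]).
    Hence the weight [F(P)] of all completions of a walk with stack [P]
    satisfies a linear recursion ([completionsS]):
      [F(P) = [|P| = 1] + x * \sum_(u not in P) F(P u)
              + x * \sum_i w(P_i ... P_m) * F(P_0 ... P_i)].
    On the other hand, let [D(P, i)] be the sum over the self-avoiding
    extensions of [P] that close at [P_i], each weighted by the resulting cycle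
    and by the heaps that avoid the extension ([exits]). Splitting off the first
    new vertex gives a recursion of the same kind ([exits_rec]). Moreover, for
    a stack [P v] and the position of [v], the extensions are the cycles through
    [v] off [P], and deleting [v] from the heaps off [P] evaluates the sum
    ([exits_top]):
      [D(P v, |P|) = h_(V - P v) - h_(V - P)].
    Combining these facts, the difference of the two sides in
      [h_(V - P) * F(P v) = \sum_(i < |P|) D(P v, i) * F(P_0 ... P_i)
                            + [P empty] * h_(V - v)]
    satisfies [defect(P v) = x * \sum_u defect(P v u)] ([defect_rec]). Stacks
    have at most [n] vertices, so all these defects vanish ([defect_low]), and
    the case of empty [P] is the identity above. Series are truncated at a
    degree [N] beyond the coefficient of interest, which keeps everything in the
    ring of polynomials. *)

Set Implicit Arguments.
Unset Strict Implicit.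
Unset Printing Implicit Defensive.
Import GRing.Theory.
Local Open Scope ring_scope.

(** * Signed heaps supported on a vertex set *)
Section Heaps.
Variables (R : comNzRingType) (n c : nat) (A : 'I_c -> 'M[R]_n).
Implicit Types (S : {set 'I_n}) (gj hk : colored_cycle n c)
  (M : {set colored_cycle n c}) (g : {set 'I_n * 'I_n}).

(** Colors enter both sides of the theorem only through this sum: a heap
    chooses one color per cycle, a freelike walk one color per piece. *)
Definition total_weight g : R := \sum_(j < c) cycle_weight (A j) g.

(** Unlike [trivial_heap], zero weights are admitted: the support [S] is then
    the only constraint that changes when a vertex or a cycle is deleted, and
    heaps containing a cycle of weight zero contribute nothing. *)
Definition heap_on S M : bool :=
  [forall gj in M, is_cycle gj.1 && (cycle_vertices gj.1 \subset S)] &&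
  [forall gj in M, forall hk in M, (gj != hk) ==>
     [disjoint cycle_vertices gj.1 & cycle_vertices hk.1]].

Definition heap_term M : {poly R} :=
  ((-1) ^+ #|M| * heap_weight A M) *: 'X^(heap_length M).

Definition heap_poly S : {poly R} := \sum_(M | heap_on S M) heap_term M.

Lemma heap_onP S M :
  reflect [/\ forall gj, gj \in M -> is_cycle gj.1,
              forall gj, gj \in M -> cycle_vertices gj.1 \subset S
            & forall gj hk, gj \in M -> hk \in M -> gj != hk ->
                [disjoint cycle_vertices gj.1 & cycle_vertices hk.1]]
          (heap_on S M).
Proof.
apply: (iffP andP) => [[/forall_inP cM /forall_inP dM] | [cM sM dM]].
  split=> [gj /cM /andP[] // | gj /cM /andP[] // | gj hk gjM hkM ne].
  by have /forall_inP/(_ _ hkM)/implyP := dM _ gjM; apply.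
split; apply/forall_inP => gj gjM; first by rewrite cM ?sM.
by apply/forall_inP => hk hkM; apply/implyP => ne; apply: dM.
Qed.

Lemma coef_heap_poly k : (heap_poly setT)`_k = additive_coef A k.
Proof.
rewrite /heap_poly /additive_coef coef_sum.
rewrite [LHS](bigID (fun M => heap_length M == k)) /= [X in _ + X]big1 ?addr0;
  last by move=> M /andP[_ /negPf nk]; rewrite coefZ coefXn eq_sym nk mulr0.
rewrite [LHS](bigID (@trivial_heap R n c A)) /= [X in _ + X]big1 ?addr0.
  apply: eq_big => [M | M /andP[/andP[_ /eqP <-] _]]; last first.
    by rewrite coefZ coefXn eqxx mulr1.
  rewrite andbAC; congr (_ && _); apply/andb_idl => /andP[/forall_inP cM dM].
  rewrite /heap_on dM andbT; apply/forall_inP => gj /cM /andP[-> _] /=.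
  exact: subsetT.
move=> M /andP[/andP[/heap_onP[cM _ dM] _]]; rewrite /trivial_heap negb_and.
case/orP=> /forall_inPn[gj gjM].
  rewrite negb_and cM //= negbK => /eqP w0.
  by rewrite coefZ /heap_weight (bigD1 gj) //= w0 mul0r mulr0 mul0r.
case/forall_inPn=> hk hkM; rewrite negb_imply => /andP[ne].
by rewrite dM.
Qed.

Lemma cycle_vertices_arc_set (v : 'I_n) p :
  cycle_vertices (arc_set (v :: p)) = [set x in belast v p].
Proof.
apply/setP=> x; rewrite inE; apply/imsetP/idP => [[a] | xb].
  rewrite inE arcs_cons => /(map_f fst).
  by rewrite -/(unzip1 _) unzip1_zip ?size_belast // => h ->.
have : x \in unzip1 (arcs (v :: p)).
  by rewrite arcs_cons unzip1_zip // size_belast.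
by case/mapP=> a aw ->; exists a; rewrite ?inE.
Qed.

Lemma perm_belast_closed (T : eqType) (v : T) p :
  closed_walk (v :: p) -> perm_eq (belast v p) p.
Proof.
move=> cw; have /eqP lp : last v p == v := cw.
have e : v :: p = rcons (belast v p) v by rewrite lastI lp.
by rewrite -(perm_cons v) perm_sym e perm_rcons.
Qed.

Lemma card_cycle_vertices g : is_cycle g -> #|cycle_vertices g| = #|g|.
Proof.
case/is_cycleP => -[|v p] [] // cw sw _ ->.
rewrite -[RHS]/(cycle_length _) (cycle_length_arc_set cw sw).
have up : uniq p by move: cw sw => /= -> /orP[/andP[] | ].
rewrite cycle_vertices_arc_set cardsE (eq_card (perm_mem (perm_belast_closed cw))).
exact/card_uniqP.
Qed.

Definition covers M (v : 'I_n) : bool :=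
  [exists gj in M, v \in cycle_vertices gj.1].

Lemma heap_onD1 S M v :
  heap_on (S :\ v) M = heap_on S M && ~~ covers M v.
Proof.
apply/heap_onP/andP => [[cM sM dM] | [/heap_onP[cM sM dM] nv]].
  split; first by apply/heap_onP; split=> // gj /sM /subsetD1P[].
  by rewrite negb_exists_in; apply/forall_inP => gj /sM /subsetD1P[].
split=> // gj gjM; apply/subsetD1P; split; first exact: sM.
by move: nv; rewrite negb_exists_in => /forall_inP; apply.
Qed.

(** Disjointness of the cycles of a heap makes the number of its cycles through
    a given vertex 0 or 1; double counting then gives [heap_length_covers]. *)
Lemma sum_covers S M v : heap_on S M ->
  (\sum_(gj in M) (v \in cycle_vertices gj.1) = covers M v)%N.
Proof.
case/heap_onP=> cM sM dM; case: (boolP (covers M v)) => [/exists_inP[gj gjM vg] | ].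
  rewrite (bigD1 gj) //= vg big1 // => hk /andP[hkM ne].
  by rewrite (disjointFl (dM _ _ hkM gjM ne) vg).
by rewrite negb_exists_in => /forall_inP nv; rewrite big1 // => gj /nv /negPf->.
Qed.

Lemma heap_length_covers S M : heap_on S M ->
  heap_length M = (\sum_v covers M v)%N.
Proof.
move=> hM; have [cM _ _] := heap_onP _ _ hM.
under eq_bigr => v _ do rewrite -(sum_covers v hM).
rewrite exchange_big; apply: eq_bigr => gj gjM.
rewrite /colored_length /cycle_length -card_cycle_vertices ?cM //.
by rewrite -sum1_card big_mkcond; apply: eq_bigr => v _; case: ifP.
Qed.

Lemma heap_length_le S M : heap_on S M -> (heap_length M <= n)%N.
Proof.
move=> hM; rewrite (heap_length_covers hM) -[X in (_ <= X)%N]card_ord -sum1_card.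
by apply: leq_sum => v _; case: covers.
Qed.

Lemma additive_coef_gt k : (n < k)%N -> additive_coef A k = 0.
Proof.
move=> nk; rewrite -coef_heap_poly coef_sum big1 // => M hM.
rewrite coefZ coefXn gtn_eqF ?mulr0 //; exact: leq_ltn_trans (heap_length_le hM) nk.
Qed.

(** A heap of length [k] avoids exactly [n - k] vertices, hence it is counted
    [n - k] times on the left. This is the shape of the coefficients of the
    derivative of a polynomial of degree [n]. *)
Lemma coef_sum_heap_polyC1 k :
  (\sum_v heap_poly (~: [set v]))`_k = additive_coef A k *+ (n - k).
Proof.
have -> : \sum_v heap_poly (~: [set v]) =
    \sum_(M | heap_on setT M) heap_term M *+ (n - heap_length M).
  rewrite /heap_poly.
  under eq_bigr => v _ do rewrite -setTD big_mkcond.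
  rewrite exchange_big [RHS]big_mkcond /=; apply: eq_bigr => M _.
  case: ifP => hM; last by rewrite big1 // => v _; rewrite heap_onD1 hM.
  under eq_bigr => v _ do rewrite heap_onD1 hM /=.
  rewrite -big_mkcond /= sumr_const; congr (_ *+ _).
  rewrite (heap_length_covers hM) -[X in (X - _)%N](card_ord n).
  rewrite -(cardC (covers M)) -[X in (_ - X)%N]big_mkcond /= -sum1_card.
  by rewrite -[X in (_ - X)%N]/(\sum_(v in covers M) 1)%N !sum1_card addKn.
rewrite coef_sum -coef_heap_poly coef_sum -sumrMnl; apply: eq_bigr => M hM.
rewrite coefMn coefZ coefXn; case: eqP => [->//|_].
by rewrite mulr0 !mul0rn.
Qed.

(** Removing the colored cycle [gj] from a heap that contains it leaves an
    arbitrary heap on the complement of the cycle; the sign comes from the loss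
    of one cycle. *)
Lemma sum_heaps_through S gj v :
    is_cycle gj.1 -> v \in cycle_vertices gj.1 -> cycle_vertices gj.1 \subset S ->
  \sum_(M | heap_on S M && (gj \in M)) heap_term M
  = - (colored_weight A gj *: 'X^#|gj.1|) * heap_poly (S :\: cycle_vertices gj.1).
Proof.
move=> cg vg sg.
have gjN M : heap_on (S :\: cycle_vertices gj.1) M -> gj \notin M.
  case/heap_onP=> _ sM _; apply/negP => /sM/subsetP/(_ _ vg).
  by rewrite inE vg.
rewrite (reindex_onto (fun M => gj |: M) (fun M => M :\ gj)) /=; last first.
  by move=> M /andP[_ gjM]; rewrite setD1K.
rewrite /heap_poly big_distrr /=; apply: eq_big => [M | M].
  apply/idP/idP => [/andP[/andP[/heap_onP[cM sM dM] _] /eqP eM] | hM].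
    have Ngj : gj \notin M by rewrite -eM !inE eqxx.
    apply/heap_onP; split=> [hk hkM | hk hkM | hk hk' hkM hk'M ne].
    - by apply: cM; rewrite inE hkM orbT.
    - rewrite subsetD sM ?inE ?hkM ?orbT //=.
      apply: dM; rewrite ?inE ?eqxx ?hkM ?orbT //.
      by apply: contraNneq Ngj => <-.
    by apply: dM; rewrite ?inE ?hkM ?hk'M ?orbT.
  have [cM sM dM] := heap_onP _ _ hM.
  rewrite setU1K ?gjN // eqxx setU11 !andbT; apply/heap_onP.
  have sMD hk : hk \in M -> [disjoint cycle_vertices hk.1 & cycle_vertices gj.1].
    by move/sM; rewrite subsetD => /andP[].
  split=> [hk | hk | hk hk'].
  - by case/setU1P=> [-> // | /cM].
  - by case/setU1P=> [-> // | /sM]; rewrite subsetD => /andP[].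
  case/setU1P=> [-> | hkM] /setU1P[-> | hk'M]; rewrite ?eqxx // => ne.
  - by rewrite disjoint_sym sMD.
  - exact: sMD.
  exact: dM.
case/andP=> _ /eqP eM; have Ngj : gj \notin M by rewrite -eM !inE eqxx.
rewrite /heap_term /heap_weight /heap_length cardsU1 Ngj !big_setU1 //=.
rewrite !exprD expr1 /colored_length /cycle_length.
move: (_ ^+ #|M|) (\prod_(_ in _) _) ('X^#|_|) ('X^(\sum_(_ in _) _)) => s w X1 X2.
move: (colored_weight A gj) => w1.
rewrite -!mul_polyC !polyCM polyCN polyC1; ring.
Qed.

(** A heap on [S] either avoids [v] or has exactly one cycle through [v], which
    is then split off by [sum_heaps_through]; for the usual characteristic
    polynomial this is the expansion of a determinant along the cycles
    through [v]. *)
Lemma heap_poly_delete S v : v \in S ->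
  heap_poly S = heap_poly (S :\ v)
    - \sum_(g | [&& is_cycle g, v \in cycle_vertices g & cycle_vertices g \subset S])
        total_weight g *: 'X^#|g| * heap_poly (S :\: cycle_vertices g).
Proof.
move=> vS; rewrite {1}/heap_poly (bigID (fun M => covers M v)) /= addrC.
congr (_ + _); first by apply: eq_bigl => M; rewrite heap_onD1.
transitivity (\sum_(M | heap_on S M)
    \sum_(gj in M | v \in cycle_vertices gj.1) heap_term M).
  rewrite big_mkcondr; apply: eq_bigr => M hM.
  rewrite sumr_const; have := sum_covers v hM.
  rewrite -sum1_card -big_mkcondr /= => h.
  rewrite [X in _ *+ X](_ : _ = covers M v :> nat); last exact: h.
  by case: covers.
rewrite (exchange_big_dep xpredT) //= -sumrN.
pose F g j := \sum_(M | [&& heap_on S M, (g, j) \in M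
    & v \in cycle_vertices g]) heap_term M.
transitivity (\sum_gj F gj.1 gj.2); first by apply: eq_bigr => -[].
rewrite -(pair_bigA _ F) /=.
rewrite [RHS]big_mkcond; apply: eq_bigr => g _; case: ifPn => [/and3P[cg vg sg] | Ng].
  rewrite -mulNr -scaleNr /total_weight -sumrN scaler_suml mulr_suml.
  apply: eq_bigr => j _.
  rewrite /F; under eq_bigl => M do rewrite vg andbT.
  by rewrite (sum_heaps_through (gj := (g, j)) cg vg sg) scaleNr.
rewrite big1 // => j _; rewrite /F big_pred0 // => M; apply: contraNF Ng.
by case/and3P=> /heap_onP[cM sM _] gM ->; rewrite (cM _ gM) (sM _ gM).
Qed.
End Heaps.

(** * Cycles as self-avoiding sequences *)

Lemma big_tuple_cons (V : nmodType) (T : finType) q (C : pred (seq T))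
    (F : seq T -> V) :
  \sum_(r : q.+1.-tuple T | C r) F r
  = \sum_u \sum_(r : q.-tuple T | C (u :: r)) F (u :: r).
Proof.
rewrite pair_big_dep /= (reindex (fun p : T * q.-tuple T => [tuple of p.1 :: p.2])) //=.
exists (fun r => (thead r, [tuple of behead r])) => [[u r] _ | r _].
  by rewrite theadE; congr (_, _); apply: val_inj.
by rewrite [r]tuple_eta; apply: val_inj.
Qed.

Section Loops.
Variables (R : comNzRingType) (n c : nat) (A : 'I_c -> 'M[R]_n).
Implicit Types (P Q s : seq 'I_n) (g : {set 'I_n * 'I_n}) (v u : 'I_n).

(** Using [take 1] for the return to the first vertex avoids a default value for
    empty [s]. *)
Definition loop s : seq 'I_n := s ++ take 1 s.

Lemma loop_cons v s : loop (v :: s) = v :: rcons s v.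
Proof. by rewrite /loop /= take0 cats1. Qed.

Lemma loop_cycle v s : uniq (v :: s) ->
  [/\ is_cycle (arc_set (loop (v :: s))), #|arc_set (loop (v :: s))| = (size s).+1
    & cycle_vertices (arc_set (loop (v :: s))) = [set x in v :: s]].
Proof.
move=> us; rewrite loop_cons.
have cw : closed_walk (v :: rcons s v) by rewrite /= last_rcons.
have sw : self_avoiding (v :: rcons s v).
  by rewrite /self_avoiding cw rcons_uniq -cons_uniq us orbT.
split.
- by apply/is_cycleP; exists (v :: rcons s v); rewrite // /walk_length /= size_rcons.
- by rewrite -[LHS]/(cycle_length _) cycle_length_arc_set // /walk_length /= size_rcons.
by rewrite cycle_vertices_arc_set belast_rcons.
Qed.

Lemma rot_rcons_inj (T : eqType) (v : T) (s s' : seq T) i :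
  uniq (rcons s' v) -> rcons s v = rot i (rcons s' v) -> s = s'.
Proof.
rewrite rcons_uniq => /andP[Nv us'].
have [le_i | lt_i] := leqP (size (rcons s' v)) i.
  by rewrite rot_oversize // => /rcons_inj[].
case: i => [|i] in lt_i *; first by rewrite rot0 => /rcons_inj[].
rewrite size_rcons ltnS in lt_i; move/(congr1 (last v)).
rewrite last_rcons /rot last_cat -cats1 takel_cat // => e.
case: s' lt_i Nv {us'} e => // x s' _ Nv /= e; case/negP: Nv.
rewrite e; have := mem_last x (take i s'); rewrite !inE.
by case/orP=> [-> // | /mem_take ->]; rewrite orbT.
Qed.

(** Both closed walks start at [v], which occurs only once before the return,
    so the rotation provided by [arc_set_rot] is trivial. *)
Lemma loop_inj v s s' : uniq (v :: s) -> uniq (v :: s') ->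
  arc_set (loop (v :: s)) = arc_set (loop (v :: s')) -> s = s'.
Proof.
move=> us us'; rewrite !loop_cons => /arc_set_rot e.
have cw x : closed_walk (v :: rcons x v) by rewrite /= last_rcons.
have sw x : uniq (v :: x) -> self_avoiding (v :: rcons x v).
  by move=> ux; rewrite /self_avoiding cw rcons_uniq -cons_uniq ux orbT.
have [||||||i] := e; rewrite ?size_rcons ?cw ?sw //.
by move/rot_rcons_inj=> -> //; rewrite rcons_uniq -cons_uniq.
Qed.

(** With [loop_inj], this identifies the cycles through [v] with the
    self-avoiding sequences that start at [v]. *)
Lemma cycle_loop g v : is_cycle g -> v \in cycle_vertices g ->
  exists2 s, uniq (v :: s) & g = arc_set (loop (v :: s)).
Proof.
case/is_cycleP => -[|u p] [] // cw sw lw ->.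
rewrite cycle_vertices_arc_set inE (perm_mem (perm_belast_closed cw)) => vp.
have up : uniq p by move: cw sw => /= -> /orP[/andP[] | ].
have def_s := rot_index vp; set s := _ ++ _ in def_s.
have us : uniq (v :: s) by rewrite -def_s rot_uniq.
exists s; rewrite ?loop_cons //; apply/arc_set_rot=> //.
- by rewrite /= last_rcons.
- by rewrite /self_avoiding /= last_rcons eqxx rcons_uniq -cons_uniq us orbT.
- by rewrite size_rcons.
by exists (index v p).+1; rewrite rotS ?index_mem // def_s rot1_cons.
Qed.

(** Sum over the self-avoiding extensions [P ++ Q] of the stack [P] that are
    closed by an arc from their end to the [i]-th vertex of [P]. The heap factor
    lives off the whole extension, and the exponent counts only the arcs that
    are added to [P]. *)
Definition exits P i : {poly R} :=
  \sum_(q < n) \sum_(Q : q.-tuple 'I_n | uniq (P ++ Q))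
    total_weight A (arc_set (loop (drop i (P ++ Q)))) *: 'X^(q.+1)
      * heap_poly A (~: [set x in P ++ Q]).

(** Closing at the last vertex [v] of the stack produces each cycle through [v]
    that avoids [P] exactly once, so [heap_poly_delete] evaluates the sum. *)
Lemma exits_top P v : uniq (rcons P v) ->
  exits (rcons P v) (size P)
  = heap_poly A (~: [set x in rcons P v]) - heap_poly A (~: [set x in P]).
Proof.
move=> uPv; set S := ~: [set x in P].
have vS : v \in S by move: uPv; rewrite rcons_uniq !inE => /andP[].
rewrite (heap_poly_delete A vS) opprB addrCA.
have -> : S :\ v = ~: [set x in rcons P v].
  by apply/setP=> x; rewrite !inE mem_rcons inE negb_or.
rewrite subrr addr0.
(* Cycles are sorted by the number q of vertices added after v; the default
   value v of insubd is never taken on cycles. *)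
pose len g : 'I_n := insubd v #|g|.-1.
have lenE g : is_cycle g -> v \in cycle_vertices g -> len g = #|g|.-1 :> nat.
  move=> cg vg; have := max_card (cycle_vertices g); rewrite card_ord.
  rewrite card_cycle_vertices // => le_gn; rewrite val_insubd; case: ifP => // /negbT.
  have : (0 < #|g|)%N by rewrite -card_cycle_vertices //; apply/card_gt0P; exists v.
  by case: #|g| le_gn => // m ->.
rewrite (partition_big len xpredT) //=; apply: eq_bigr => q _.
pose Qs := [set Q : q.-tuple 'I_n | uniq (rcons P v ++ Q)].
pose h (Q : q.-tuple 'I_n) := arc_set (loop (v :: Q)).
have dropE Q : drop (size P) (rcons P v ++ Q) = v :: Q by rewrite cat_rcons drop_size_cat.
have uE Q : uniq (rcons P v ++ Q) -> uniq (v :: Q).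
  by rewrite cat_rcons cat_uniq => /and3P[].
have inj_h : {in Qs &, injective h}.
  by move=> Q Q'; rewrite !inE => /uE uQ /uE uQ' /(loop_inj uQ uQ') /val_inj.
have Qs_h : [set g | [&& is_cycle g, v \in cycle_vertices g
   & cycle_vertices g \subset S] && (len g == q)] = h @: Qs.
  apply/setP=> g; rewrite !inE; apply/andP/imsetP => [[/and3P[cg vg sg] /eqP lq] | [Q]].
    have [s us def_g] := cycle_loop cg vg; have [_ card_g Vg] := loop_cycle us.
    have szs : size s == q by rewrite -lq lenE // def_g card_g.
    exists (Tuple szs) => //; rewrite inE cat_rcons cat_uniq us andbT.
    move: uPv; rewrite rcons_uniq => /andP[_ ->]; rewrite andTb.
    apply/hasPn=> x xs; move/subsetP/(_ x): sg; rewrite def_g Vg !inE.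
    by apply; rewrite -in_cons.
  rewrite inE => uPQ ->; have [cQ lQ VQ] := loop_cycle (uE _ uPQ).
  have vQ : v \in cycle_vertices (h Q) by rewrite VQ inE mem_head.
  split; last by apply/eqP/val_inj; rewrite /= lenE // lQ size_tuple.
  apply/and3P; split=> //; rewrite VQ; apply/subsetP=> x; rewrite !inE => xQ.
  move: uPQ; rewrite cat_rcons cat_uniq => /and3P[_ /hasPn + _].
  by apply; rewrite in_cons.
transitivity (\sum_(g in h @: Qs)
    total_weight A g *: 'X^#|g| * heap_poly A (S :\: cycle_vertices g)).
  rewrite big_imset //=; apply: eq_big => [Q | Q /uE uQ]; first by rewrite inE.
  have [_ cQ VQ] := loop_cycle uQ; rewrite dropE -/(h Q) cQ VQ size_tuple.
  rewrite (_ : ~: _ = S :\: [set x in v :: Q]) //.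
  apply/setP=> x.
  by rewrite cat_rcons !inE mem_cat in_cons negb_or andbC.
by apply: eq_bigl => g; move/setP/(_ g): Qs_h; rewrite inE => ->.
Qed.

(** Either the extension [Q] is empty or it has a first vertex [u]. *)
Lemma exits_rec P i :
  (i < size P)%N -> uniq P ->
  exits P i =
   total_weight A (arc_set (loop (drop i P))) *: 'X
     * heap_poly A (~: [set x in P])
   + 'X * \sum_(u | u \notin P) exits (rcons P u) i.
Proof.
move=> lt_i uP.
pose f q := \sum_(Q : q.-tuple 'I_n | uniq (P ++ Q))
    total_weight A (arc_set (loop (drop i (P ++ Q)))) *: 'X^(q.+1)
      * heap_poly A (~: [set x in P ++ Q]).
(* No self-avoiding sequence has more than n vertices, so one more value of the
   length of Q can be allowed; this makes room for the shift of index. *)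
have fn : f n = 0.
  apply: big1 => Q uPQ; have := max_card (mem (P ++ Q)).
  rewrite card_ord (card_uniqP uPQ) size_cat size_tuple leqNgt -{1}[n]add0n ltn_add2r.
  by case: P lt_i {uP f uPQ}.
transitivity (\sum_(q < n.+1) f q); first by rewrite big_ord_recr /= fn addr0.
rewrite big_ord_recl; congr (_ + _).
  rewrite /f (big_pred1 [tuple]) /= ?cats0 // => Q.
  by rewrite [Q]tuple0 /= cats0 uP; apply/esym/eqP.
have fS q : f q.+1 = 'X * \sum_(u | u \notin P)
  \sum_(Q : q.-tuple 'I_n | uniq (rcons P u ++ Q))
    total_weight A (arc_set (loop (drop i (rcons P u ++ Q)))) *: 'X^(q.+1)
      * heap_poly A (~: [set x in rcons P u ++ Q]).
  rewrite /f (big_tuple_cons _ (fun Q => uniq (P ++ Q)) (fun Q =>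
    total_weight A (arc_set (loop (drop i (P ++ Q)))) *: 'X^(q.+2)
      * heap_poly A (~: [set x in P ++ Q]))).
  rewrite big_distrr [RHS]big_mkcond; apply: eq_bigr => u _ /=.
  case: ifPn => [Pu | /negbNE Pu].
    rewrite big_distrr; apply: eq_big => Q; rewrite /= ?cat_rcons // => _.
    by rewrite [in LHS]exprS -!scalerAl -!scalerAr mulrA.
  rewrite big_pred0 // => Q; rewrite cat_uniq /= Pu /=; exact: andbF.
under eq_bigr => q _ do rewrite lift0 fS.
by rewrite -big_distrr /= exchange_big.
Qed.
End Loops.

(** * Loop erasure as a stack process *)
Section Stack.
Variables (R : comNzRingType) (n c : nat) (A : 'I_c -> 'M[R]_n).
Implicit Types (P r : seq 'I_n) (u : 'I_n).

(** The first repetition of [P ++ u :: r] is the arrival at [u] : this cuts the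
    stack back to [u] and emits the part that is cut off, closed up. *)
Lemma pieces_push P u r : uniq P -> u \in P ->
  pieces (P ++ u :: r)
  = loop (drop (index u P) P) :: pieces (take (index u P).+1 P ++ r).
Proof.
move=> uP Pu; set w := P ++ u :: r.
have Nu1 : ~~ uniq (take (size P).+1 w).
  by rewrite /w -cat_rcons -(size_rcons P u) take_size_cat // rcons_uniq Pu.
have Nu : ~~ uniq w by apply: contra Nu1; apply: take_uniq.
have tE : first_repeat w = size P.
  have [_ Nt ut] := first_repeatP Nu; apply/eqP; rewrite eqn_leq.
  apply/andP; split; rewrite leqNgt; apply/negP => lt_t.
    by case/negP: Nu1; rewrite -(take_takel w lt_t) take_uniq.
  by case/negP: Nt; rewrite /w takel_cat // take_uniq.
have lt_i : (index u P < size P)%N by rewrite index_mem.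
have sE : repeat_start w = index u P.
  by rewrite /repeat_start tE drop_size_cat // index_cat Pu.
have iE : nth u P (index u P) = u by rewrite nth_index.
rewrite pieces_cons // /first_piece /erase_piece sE tE; congr (_ :: pieces _).
  rewrite /w -cat_rcons -(size_rcons P u) take_size_cat // drop_rcons ?(ltnW lt_i) //.
  by rewrite (drop_nth u lt_i) iE loop_cons.
by rewrite drop_size_cat // takel_cat ?(ltnW lt_i) // (take_nth u lt_i) iE cat_rcons.
Qed.

(** Total weight of the ways to finish, in [t] steps, a closed freelike walk
    whose current loop-erased trace is [P]; for [P = [:: v]] these are all closed
    freelike walks of length [t] at [v]. *)
Definition completions t P : R :=
  \sum_(r : t.-tuple 'I_n | closed_walk (P ++ r))
     \prod_(p <- pieces (P ++ r)) total_weight A (arc_set p).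

Lemma completions0 P : uniq P -> (0 < size P)%N ->
  completions 0 P = (size P == 1)%:R.
Proof.
move=> uP sP; rewrite /completions big_mkcond (big_pred1 [tuple]) => [|r]; last first.
  by rewrite [r]tuple0; apply/esym/eqP.
rewrite /= cats0 pieces_nil // big_nil; case: P uP sP => // x P /= /andP[xP _] _.
case: P xP => [|y P] xP; rewrite /= ?eqxx //.
by case: eqP => // xl; rewrite -xl /= mem_last in xP.
Qed.

Lemma closed_push x0 P i r : (i < size P)%N ->
  closed_walk (P ++ nth x0 P i :: r) = closed_walk (take i.+1 P ++ r).
Proof.
move=> lt_i; rewrite (take_nth x0 lt_i) cat_rcons; case: P lt_i => //= x P.
by case: i => [|i] /= lt_i; rewrite !last_cat /=.
Qed.

(** By [pieces_push], an arrival at the [i]-th vertex of the stack emits one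
    piece; any other vertex is pushed without changing the walk. *)
Lemma completionsS t P : uniq P -> (0 < size P)%N ->
  completions t.+1 P = \sum_(u | u \notin P) completions t (rcons P u)
   + \sum_(i < size P)
       total_weight A (arc_set (loop (drop i P))) * completions t (take i.+1 P).
Proof.
move=> uP sP; rewrite /completions.
rewrite (big_tuple_cons _ (fun r => closed_walk (P ++ r))
  (fun r => \prod_(p <- pieces (P ++ r)) total_weight A (arc_set p))).
rewrite (bigID (mem P)) /= addrC; congr (_ + _).
  by apply: eq_bigr => u _; apply: eq_big => r; rewrite cat_rcons.
have [x0 _] : exists x0, x0 \in P.
  by case: P sP {uP} => // x P; exists x; rewrite mem_head.
rewrite -big_uniq //= (big_nth x0) big_mkord; apply: eq_bigr => i _.
rewrite big_distrr; apply: eq_big => r; first by rewrite closed_push.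
by move=> _; rewrite pieces_push ?mem_nth // big_cons index_uniq.
Qed.

(** Walks of zero weight may be added to the sum, after which the colors of the
    pieces are chosen independently and the product of sums can be factored. *)
Lemma sum_FrWalk k :
  \sum_(W in FrWalk A k) freelike_weight A W = \sum_v completions k [:: v].
Proof.
transitivity (\sum_(W : colored_walk n c k | closed_walk (tag W)) freelike_weight A W).
  rewrite big_mkcond [RHS]big_mkcond; apply: eq_bigr => W _; rewrite inE.
  by case: closed_walk => //=; case: eqP.
pose wt (w : k.+1.-tuple 'I_n) (f : {ffun 'I_(size (pieces w)) -> 'I_c}) : R :=
  \prod_(i < size (pieces w)) colored_weight A (arc_set (nth [::] (pieces w) i), f i).
transitivity (\sum_(w : k.+1.-tuple 'I_n | closed_walk w) \sum_f wt w f).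
  rewrite (sig_big_dep _ (fun _ _ => true) wt).
  by apply: eq_big => [W | [w f] _] //=; rewrite andbT.
transitivity (\sum_(w : k.+1.-tuple 'I_n | closed_walk w)
    \prod_(p <- pieces w) total_weight A (arc_set p)).
  apply: eq_bigr => w _; rewrite (big_nth [::]) big_mkord.
  by rewrite /wt /total_weight bigA_distr_bigA.
exact: (big_tuple_cons _ (fun w => closed_walk w)
  (fun w => \prod_(p <- pieces w) total_weight A (arc_set p))).
Qed.
End Stack.

(** * Walks times heaps *)
Section Defect.
Variables (R : comNzRingType) (n c : nat) (A : 'I_c -> 'M[R]_n).
Implicit Types (P r : seq 'I_n) (u v : 'I_n).
Variable N : nat.

(** A truncated power series: identities between series become equalities of
    coefficients below [N]. *)
Definition completion_series P : {poly R} := \sum_(t < N) completions A t P *: 'X^t.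

(** The last term compensates for the truncation. *)
Lemma completion_series_rec P : uniq P -> (0 < size P)%N ->
  completion_series P = (size P == 1)%:R
   + 'X * \sum_(u | u \notin P) completion_series (rcons P u)
   + 'X * \sum_(i < size P) (total_weight A (arc_set (loop (drop i P))))%:P
                * completion_series (take i.+1 P)
   - (completions A N P) *: 'X^N.
Proof.
move=> uP sP; apply/(canRL (addrK _)).
transitivity (\sum_(t < N.+1) completions A t P *: 'X^t); first by rewrite big_ord_recr.
rewrite big_ord_recl completions0 // expr0 -addrA; congr (_ + _).
  by case: eqP; rewrite ?scale1r ?scale0r.
rewrite /completion_series exchange_big.
under [X in _ + 'X * X]eq_bigr => i _ do rewrite big_distrr.
rewrite [X in _ + 'X * X]exchange_big -mulrDr -big_split big_distrr /=.
apply: eq_bigr => t _; rewrite completionsS // exprS.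
rewrite scalerDl !scaler_suml mulrDr !big_distrr /=; congr (_ + _); apply: eq_bigr => i _.
  by rewrite scalerAr.
by rewrite -scalerA mul_polyC !scalerAr.
Qed.

(** The defect of the identity that describes a walk with stack [rcons P v]: it
    wanders off [P], then follows a self-avoiding path back to a vertex of [P],
    closing a piece, and goes on from there; for [P] empty it only wanders.
    Multiplying by the heaps off [P] removes the denominators that the closed
    walks along the path would contribute. *)
Definition defect P v : {poly R} :=
  heap_poly A (~: [set x in P]) * completion_series (rcons P v)
  - \sum_(i < size P) exits A (rcons P v) i * completion_series (take i.+1 P)
  - (P == [::])%:R * heap_poly A (~: [set v]).

(** Insert the recursions for [completion_series] and [exits]; the terms where a
    piece is closed cancel, except the one closed at [v] itself, and
    [exits_top] turns that one into the change of support from the complement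
    of [rcons P v] to the complement of [P]. *)
Lemma defect_rec P v : uniq (rcons P v) ->
  defect P v = 'X * \sum_(u | u \notin rcons P v) defect (rcons P v) u
    - completions A N (rcons P v) *: 'X^N * heap_poly A (~: [set x in rcons P v]).
Proof.
move=> uPv; have sPv : (0 < size (rcons P v))%N by rewrite size_rcons.
have := completion_series_rec uPv sPv.
have takeE i : (i < size P)%N -> take i.+1 (rcons P v) = take i.+1 P.
  by move=> ?; rewrite -cats1 takel_cat.
set h := heap_poly A _; set F := completion_series _.
pose G i := completion_series (take i.+1 (rcons P v)).
pose E i := exits A (rcons P v) i.
pose E' i := \sum_(u | u \notin rcons P v) exits A (rcons (rcons P v) u) i.
pose w i := total_weight A (arc_set (loop (drop i (rcons P v)))).
pose S := \sum_(u | u \notin rcons P v) completion_series (rcons (rcons P v) u).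
have EE' i : (i < size (rcons P v))%N -> E i = (w i)%:P * 'X * h + 'X * E' i.
  by move=> lti; rewrite [E i]exits_rec // -mul_polyC.
have Etop : E (size P) = h - heap_poly A (~: [set x in P]) by apply: exits_top.
have Gtop : G (size P) = F by rewrite /G take_oversize ?size_rcons.
have -> : \sum_(u | u \notin rcons P v) defect (rcons P v) u
     = h * S - \sum_(i < size (rcons P v)) E' i * G i.
  rewrite /defect big_split /= big_split /= -big_distrr sumrN /=.
  rewrite [X in _ + X]big1 ?addr0 => [|u _]; last first.
    by rewrite -size_eq0 size_rcons mul0r oppr0.
  congr (_ - _); rewrite exchange_big; apply: eq_bigr => i _.
  by rewrite -big_distrl.
have -> : defect P v = heap_poly A (~: [set x in P]) * F
  - \sum_(i < size P) E i * G i - (P == [::])%:R * h.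
  rewrite /defect; congr (_ - _ - _); first by apply: eq_bigr => i _; rewrite /G takeE.
  case: eqP => [P0|_]; last by rewrite !mul0r.
  by rewrite /h P0; congr (_ * heap_poly A _); apply/setP=> x; rewrite !inE.
rewrite -/S; have -> : 'X * (h * S - \sum_(i < size (rcons P v)) E' i * G i)
   = h * ('X * S) + h * ('X * \sum_(i < size (rcons P v)) (w i)%:P * G i)
     - \sum_(i < size (rcons P v)) E i * G i.
  rewrite [\sum_(i < size (rcons P v)) E i * G i](eq_bigr
    (fun i : 'I_(size (rcons P v)) =>
     h * ('X * ((w i)%:P * G i)) + 'X * (E' i * G i))); last first.
    by move=> i _; rewrite EE' //; ring.
  by rewrite big_split -!big_distrr /=; ring.
have -> : \sum_(i < size (rcons P v)) E i * G i
   = \sum_(i < size P) E i * G i + (h - heap_poly A (~: [set x in P])) * F.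
  by rewrite size_rcons big_ord_recr /= Etop Gtop.
rewrite size_rcons eqSS size_eq0 -/S -[rcons P v]/(rcons P v).
move: (\sum_(i < (size P).+1) _) (\sum_(i < size P) _) (completions A N _ *: _) => T U z.
clear EE' Etop Gtop.
move: ('X * S) ('X * T) F (heap_poly A (~: [set x in P])) => S' T' {}F h0 eF.
rewrite -mulrDr (_ : S' + T' = F - (P == [::])%:R + z); first by ring.
by rewrite eF; ring.
Qed.

(** By [defect_rec] a defect is governed by those of the longer stacks, and a
    stack cannot have more than [n] vertices. *)
Lemma defect_low P v j : uniq (rcons P v) -> (j < N)%N -> (defect P v)`_j = 0.
Proof.
have [d] := ubnP (n - size P); elim: d P v j => // d IH P v j le_d uPv lt_jN.
rewrite defect_rec // coefB coefXM -scalerAl coefZ coefXnM lt_jN mulr0 subr0.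
case: j lt_jN => //= j lt_jN; rewrite coef_sum big1 // => u Nu.
apply: IH; rewrite ?rcons_uniq ?Nu -?rcons_uniq //; last exact: ltnW.
have : (size (rcons P v) <= n)%N.
  by rewrite -(card_uniqP uPv) -[X in (_ <= X)%N]card_ord max_card.
rewrite size_rcons => lt_Pn; rewrite subnS.
by case: (n - size P)%N (subn_gt0 (size P) n) le_d => [|m]; rewrite ?lt_Pn.
Qed.

End Defect.

(** * Comparison with the power sums *)
Section Newton.
Variables (R : comNzRingType) (n c : nat) (A : 'I_c -> 'M[R]_n).

(** For the stack [[:: v]] the vanishing of the defect says that
    [heap_poly setT] times the series of closed walks at [v] is [heap_poly] of the
    complement of [v]; now sum over [v]. This has the form of
    [power_sum_series], with walks in place of power sums. *)
Lemma additive_coef_completions k :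
  \sum_(i < k.+1) additive_coef A i * \sum_v completions A (k - i) [:: v]
  = additive_coef A k *+ (n - k).
Proof.
pose F v := completion_series A k.+1 [:: v].
have -> : additive_coef A k *+ (n - k) = (heap_poly A setT * \sum_v F v)`_k.
  rewrite -coef_sum_heap_polyC1 big_distrr /= !coef_sum; apply: eq_bigr => v _.
  have := @defect_low _ _ _ A k.+1 [::] v k isT (ltnSn k).
  rewrite /defect big_ord0 subr0 eqxx mul1r coefB => /eqP.
  rewrite subr_eq0 => /eqP <-; congr ((heap_poly A _ * _)`_k).
  by apply/setP=> x; rewrite !inE.
rewrite coefM; apply: eq_bigr => i _; rewrite coef_heap_poly coef_sum.
congr (_ * _); apply: eq_bigr => v _.
rewrite /F /completion_series coef_sum (bigD1 (inord (k - i))) //=.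
rewrite coefZ coefXn inordK ?ltnS ?leq_subr // eqxx mulr1 big1 ?addr0 // => j ne.
rewrite coefZ coefXn [_ == _](_ : _ = false) ?mulr0 //.
by apply: contraNF ne => /eqP ->; rewrite inord_val.
Qed.

Lemma coef_additive_char_poly i : (i <= n)%N ->
  (additive_char_poly A)`_(n - i) = additive_coef A i.
Proof.
move=> le_in; rewrite /additive_char_poly coef_sum (bigD1 (inord i)) //=.
rewrite coefZ coefXn inordK // eqxx mulr1 big1 ?addr0 // => j ne.
rewrite coefZ coefXn [_ == _](_ : _ = false) ?mulr0 //.
apply: contraNF ne => /eqP e; rewrite -[j]inord_val; apply/eqP; congr inord.
by rewrite -(subKn le_in) e subKn // -ltnS.
Qed.

End Newton.

Theorem theorem4p23 (R : comNzRingType) (n c : nat) (A : 'I_c -> 'M[R]_n)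
    (k : nat) (hk : (1 <= k)%N) :
  power_sum_roots (additive_char_poly A) k
  = \sum_(W in FrWalk A k) freelike_weight A W.
Proof.
(* Since the coefficient of index 0 is 1, Newton's relations determine the power
   sums; they hold for the closed walks too, down to k = 0, where both sides
   are n. *)
rewrite sum_FrWalk {hk}; elim/ltn_ind: k => k IH.
have /= := power_sum_series k (monic_additive_char_poly A).
rewrite size_additive_char_poly /=.
have bE i :
    (if (i <= n)%N then (additive_char_poly A)`_(n - i) else 0) = additive_coef A i.
  by case: leqP => [/coef_additive_char_poly | /additive_coef_gt ->].
have -> : (if (k <= n)%N then (additive_char_poly A)`_(n - k) *+ (n - k) else 0)
    = additive_coef A k *+ (n - k).
  by rewrite -bE; case: ifP => // _; rewrite mul0rn.
under eq_bigr => i _ do rewrite bE.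
rewrite -additive_coef_completions !big_ord_recl /= !subn0 additive_coef0 !mul1r.
rewrite [in LHS](eq_bigr (fun i : 'I_k =>
  additive_coef A i.+1 * \sum_v completions A (k - i.+1) [:: v])).
  exact: addIr.
by move=> i _; rewrite /bump /= add1n IH // ltn_subrL (leq_trans _ (ltn_ord i)).
Qed.
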